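(* Let $M,N,L\ge 1$ be integers with $L\ge M$ and $L\ge N$, let $\mathbf{R}_{\mathrm T}\in\mathbb{C}^{M\times M}$ be Hermitian positive definite with eigendecomposition $\mathbf{R}_{\mathrm T}=\mathbf{U}_{\mathrm T}^{\mathsf H}\,\mathrm{diag}\{\lambda_1,\dots,\lambda_M\}\,\mathbf{U}_{\mathrm T}$ ($\mathbf{U}_{\mathrm T}$ unitary, $\lambda_m>0$). Let $\sigma^2=1+\mathrm{tr}(\mathbf{R}_{\mathrm T}\mathbf{\Sigma})$, with $\mathbf{\Sigma}\in\mathbb{C}^{M\times M}$ the (positive semidefinite) averaged downlink communication covariance described in the context. For $p_{\mathrm s}>0$ define the maximal downlink sensing rate $$\mathcal{R}_{\mathrm d,s}=\frac1L\max_{\mathbf{S}\in\mathbb{C}^{M\times L},\ \mathrm{tr}(\mathbf{S}\mathbf{S}^{\mathsf H})\le p_{\mathrm s}}N\log_2\det\big(\mathbf{I}_L+\sigma^{-2}\mathbf{S}^{\mathsf H}\mathbf{R}_{\mathrm T}\mathbf{S}\big).$$ Then $$\mathcal{R}_{\mathrm d,s}=\frac{N}{L}\sum_{m=1}^{M}\log_2\big(1+\sigma^{-2}\lambda_m s_m^{\star}\big),\qquad s_m^{\star}=\max\Big\{0,\frac1\nu-\frac{\sigma^2}{\lambda_m}\Big\},$$ where $\nu$ is determined by $\sum_{m=1}^{M}\max\{0,\frac1\nu-\frac{\sigma^2}{\lambda_m}\}=p_{\mathrm s}$. The maximal sensing rate is achieved when $\mathbf{S}\mathbf{S}^{\mathsf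 H}=\mathbf{U}_{\mathrm T}^{\mathsf H}\mathbf{\Delta}^{\star}\mathbf{U}_{\mathrm T}$ with $\mathbf{\Delta}^{\star}=\mathrm{diag}\{s_1^{\star},\dots,s_M^{\star}\}$. When $p_{\mathrm s}\to\infty$, $$\mathcal{R}_{\mathrm d,s}\approx\frac{NM}{L}\Big(\log_2 p_{\mathrm s}+\frac1M\sum_{m=1}^{M}\log_2\Big(\frac{\lambda_m}{M\sigma^2}\Big)\Big).$$
   Context: $(\cdot)^{\mathsf H}$ is the conjugate transpose. The symbol $\approx$ denotes a high-SNR approximation (as $p_{\mathrm s}\to\infty$), for which no explicit error term is specified. The quantity $N\log_2\det(\mathbf{I}_L+\sigma^{-2}\mathbf{S}^{\mathsf H}\mathbf{R}_{\mathrm T}\mathbf{S})$ is the downlink sensing mutual information over $L$ symbols for a base station with $M$ transmit and $N$ receive antennas using radar waveform $\mathbf{S}$, where $\mathbf{R}_{\mathrm T}$ is the transmit correlation matrix of the target response and $p_{\mathrm s}$ is the sensing SNR. The matrix $\mathbf{\Sigma}=\mathbb{E}_{\mathbf{H}_{\mathrm d}}\{\mathbf{\Sigma}_{\mathbf{H}_{\mathrm d}}\}$ is the average over the random downlink channel matrix $\mathbf{H}_{\mathrm d}=[\mathbf{h}_1\cdots\mathbf{h}_K]\in\mathbb{C}^{M\times K}$ ($K\le M$, $K\le N$, independent columns $\mathbf{h}_k\sim\mathcal{CN}(\mathbf{0},\mathbf{R}_k)$) of the covariance $\mathbf{\Sigma}_{\mathbf{H}_{\mathrm d}}$ of the dirty-paper-coded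 communication signal, which achieves the broadcast-channel sum capacity (computed by iterative water-filling) subject to $\mathrm{tr}(\mathbf{\Sigma}_{\mathbf{H}_{\mathrm d}})\le p_{\mathrm c}$, for a fixed communication SNR $p_{\mathrm c}$. That is, $\mathbf{\Sigma}_{\mathbf{H}_{\mathrm d}}=\sum_{k=1}^K\mathbf{Q}_k$, where $\mathbf{Q}_1,\dots,\mathbf{Q}_K\succeq\mathbf{0}$ maximize the dirty-paper-coding sum rate $\sum_{k=1}^K\log_2\frac{1+\mathbf{h}_k^{\mathsf H}(\sum_{j\le k}\mathbf{Q}_j)\mathbf{h}_k}{1+\mathbf{h}_k^{\mathsf H}(\sum_{j<k}\mathbf{Q}_j)\mathbf{h}_k}$ subject to $\mathrm{tr}(\sum_k\mathbf{Q}_k)\le p_{\mathrm c}$. The matrix $\mathbf{\Sigma}$ does not depend on $\mathbf{S}$ or $p_{\mathrm s}$. *)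

(* Defs.v *)
From HB Require Import structures.
From mathcomp Require Export all_boot all_order all_algebra.
From mathcomp Require Export sesquilinear spectral.
From mathcomp Require Export complex.
From mathcomp Require Export all_classical all_reals all_analysis.

Set Implicit Arguments.
Unset Strict Implicit.
Unset Printing Implicit Defensive.

Export Order.TTheory GRing.Theory Num.Theory.
Export numFieldNormedType.Exports.

#[global] Open Scope classical_set_scope.
#[global] Open Scope ring_scope.
#[global] Open Scope complex_scope.
#[global] Open Scope sesquilinear_scope.

Definition log2 {R : realType} (x : R) : R := ln x / ln 2.

Definition is_max {R : realType} (A : set R) (x : R) : Prop :=
  A x /\ ubound A x.

(* In R[i], 0 <= z and 0 < z include the fact that z is real. *)
Definition psdmx {R : realType} {n : nat} (A : 'M[R[i]]_n) : Prop :=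
  A \is hermsymmx /\ forall x : 'cV[R[i]]_n, 0 <= (x ^t* *m A *m x) 0 0.

Definition pdmx {R : realType} {n : nat} (A : 'M[R[i]]_n) : Prop :=
  A \is hermsymmx /\
  forall x : 'cV[R[i]]_n, x != 0 -> 0 < (x ^t* *m A *m x) 0 0.

Section Random.
Context {R : realType} {d : measure_display} {T : measurableType d}.
Variable P : probability T R.

Definition measurable_cmx {m n : nat} (X : T -> 'M[R[i]]_(m, n)) : Prop :=
  forall i j, measurable_fun [set: T] (fun w => complex.Re (X w i j)) /\
              measurable_fun [set: T] (fun w => complex.Im (X w i j)).

Definition expectation_cmx {m n : nat} (X : T -> 'M[R[i]]_(m, n)) :
    'M[R[i]]_(m, n) :=
  \matrix_(i, j) (fine ('E_P[fun w => complex.Re (X w i j)])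
                  +i* fine ('E_P[fun w => complex.Im (X w i j)])).

(* Law N(0, v) for v >= 0.  The case v = 0 is separate because
   [normal_prob 0 0] is not the Dirac mass. *)
Definition centered_normal (v : R) (A : set R) : \bar R :=
  if v == 0 then \d_(0 : R) A else normal_prob 0 (Num.sqrt v) A.

(* X ~ CN(0, G), circularly symmetric, G possibly singular.  The real linear
   functionals of (Re X, Im X) are exactly the Re (u^H X), and those of a
   CN(0, G) vector are real Gaussian with variance u^H G u / 2. *)
Definition complex_normal {n : nat} (G : 'M[R[i]]_n) (X : T -> 'cV[R[i]]_n) :
    Prop :=
  measurable_cmx X /\
  forall (u : 'cV[R[i]]_n) (A : set R), measurable A ->
    P ((fun w => complex.Re ((u ^t* *m X w) 0 0)) @^-1` A) =
    centered_normal (complex.Re ((u ^t* *m G *m u) 0 0) / 2) A.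

Definition sigma_of_cvec {n : nat} (X : T -> 'cV[R[i]]_n) : set (set T) :=
  <<s [set E | exists (i : 'I_n) (B : set R), measurable B /\
         (E = (fun w => complex.Re (X w i 0)) @^-1` B \/
          E = (fun w => complex.Im (X w i 0)) @^-1` B)] >>.

(* Since E k = setT is allowed, this includes the product rule for every
   subfamily of columns. *)
Definition independent_columns {m n : nat} (H : T -> 'M[R[i]]_(m, n)) : Prop :=
  forall E : 'I_n -> set T,
    (forall k, sigma_of_cvec (fun w => col k (H w)) (E k)) ->
    P (\bigcap_(k in [set: 'I_n]) E k) = (\prod_(k < n) P (E k))%E.

End Random.

Section DirtyPaper.
Context {R : realType} {M K : nat}.
Implicit Types (H : 'M[R[i]]_(M, K)) (Q : 'I_K -> 'M[R[i]]_M).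

Definition quad_form (A : 'M[R[i]]_M) (h : 'cV[R[i]]_M) : R :=
  complex.Re ((h ^t* *m A *m h) 0 0).

Definition dpc_sum_rate H Q : R :=
  \sum_(k < K)
    log2 ((1 + quad_form (\sum_(j < K | (j <= k)%N) Q j) (col k H)) /
          (1 + quad_form (\sum_(j < K | (j < k)%N) Q j) (col k H))).

Definition dpc_feasible (pc : R) Q : Prop :=
  (forall k, psdmx (Q k)) /\ \tr (\sum_(k < K) Q k) <= pc%:C.

Definition dpc_optimal (pc : R) H Q : Prop :=
  dpc_feasible pc Q /\
  forall Q', dpc_feasible pc Q' -> dpc_sum_rate H Q' <= dpc_sum_rate H Q.

End DirtyPaper.

Section Sensing.
Context {R : realType} {M : nat}.

(* 1 + tr(RT Sigma); the trace is real when RT and Sigma are Hermitian. *)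
Definition noise_power (RT Sigma : 'M[R[i]]_M) : R :=
  1 + complex.Re (\tr (RT *m Sigma)).

(* The determinant is real and positive when RT is positive semidefinite
   and sigma2 > 0. *)
Definition sensing_mi (N : nat) {L : nat} (sigma2 : R) (RT : 'M[R[i]]_M)
    (S : 'M[R[i]]_(M, L)) : R :=
  N%:R * log2 (complex.Re
    (\det (1%:M + (sigma2^-1)%:C *: (S ^t* *m RT *m S)))).

Definition sensing_mi_values (N L : nat) (sigma2 : R) (RT : 'M[R[i]]_M)
    (ps : R) : set R :=
  [set sensing_mi N sigma2 RT S |
     S in [set S : 'M[R[i]]_(M, L) | \tr (S *m S ^t*) <= ps%:C]].

Definition max_sensing_rate (N L : nat) (sigma2 : R) (RT : 'M[R[i]]_M)
    (ps : R) : R :=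
  L%:R^-1 * sup (sensing_mi_values N L sigma2 RT ps).

Definition water_power (sigma2 : R) (lam : 'I_M -> R) (nu : R) (m : 'I_M) : R :=
  Num.max 0 (nu^-1 - sigma2 / lam m).

Definition water_level (sigma2 : R) (lam : 'I_M -> R) (ps nu : R) : Prop :=
  0 < nu /\ \sum_(m < M) water_power sigma2 lam nu m = ps.

Definition real_diag_mx (v : 'I_M -> R) : 'M[R[i]]_M :=
  diag_mx (\row_(m < M) (v m)%:C).

End Sensing.

(* Main.v *)
(* Write RT = U^H diag(lam) U and V = U S. By Sylvester's identity the sensing
   determinant is that of A = I + W W^H with W = diag(lam / sigma2)^(1/2) V. With
   D = diag(1 + lam_m s_m / sigma2) for the water-filling powers s_m, the matrix
   B = D^(-1/2) A D^(-1/2) is positive semidefinite, and mu <= e^(mu - 1) for each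
   eigenvalue mu gives det B <= e^(tr B - M). The water level makes
   tr B - M <= nu (tr S S^H - ps) <= 0, hence det A <= det D; this replaces both
   Hadamard's inequality and the Lagrangian argument. Above the threshold
   ps >= M sum_m sigma2 / lam_m all powers are nonnegative without truncation and
   the error of the high-SNR formula is exactly
   (N M / L) log2 (1 + (sum_m sigma2 / lam_m) / ps).
   That sigma2 > 0 holds because Sigma is an average of bounded positive
   semidefinite matrices. *)
Require Import Defs.
From mathcomp Require Import ring lra.

Set Implicit Arguments.
Unset Strict Implicit.
Unset Printing Implicit Defensive.

(** Sylvester's identity: one block matrix, with [B] eliminated once from the right and once from
    the left, has both sides as its determinant. *)
Lemma det_1D_mulmxC (R : comPzRingType) m n
    (A : 'M[R]_(m, n)) (B : 'M[R]_(n, m)) :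
  \det (1%:M + A *m B) = \det (1%:M + B *m A).
Proof.
have h1 : block_mx 1%:M (- A) B 1%:M =
   block_mx (1%:M + A *m B) (- A) 0 1%:M *m block_mx 1%:M 0 B 1%:M.
  by rewrite mulmx_block !mulmx1 !mul0mx !mulmx0 !add0r !mul1mx mulNmx addrK.
have h2 : block_mx 1%:M (- A) B 1%:M =
   block_mx 1%:M 0 B 1%:M *m block_mx 1%:M (- A) 0 (1%:M + B *m A).
  rewrite mulmx_block !mulmx1 !mul0mx !mulmx0 !mul1mx !addr0 mulmxN.
  by rewrite addrCA addNr addr0.
have := congr1 determinant h1; rewrite h2 !det_mulmx !det_ublock !det_lblock.
by rewrite !det1 !mulr1 !mul1r.
Qed.

(** * Conjugate transposes and Gram matrices *)

Section ConjTranspose.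
Variable C : numClosedFieldType.

Lemma trmxC_mul m n p (A : 'M[C]_(m, n)) (B : 'M[C]_(n, p)) :
  (A *m B) ^t* = B ^t* *m A ^t*.
Proof. by rewrite trmx_mul map_mxM. Qed.

Lemma trmxC_diag n (v : 'rV[C]_n) :
  v \is a realmx -> (diag_mx v) ^t* = diag_mx v.
Proof. by move=> vr; rewrite tr_diag_mx map_diag_mx realmxC. Qed.

Lemma mulmxC_diag_ge0 m n (A : 'M[C]_(m, n)) i : 0 <= (A *m A ^t*) i i.
Proof.
by rewrite mxE sumr_ge0 // => j _; rewrite !mxE mul_conjC_ge0.
Qed.

Lemma gram_hermsymmx m n (A : 'M[C]_(m, n)) : A *m A ^t* \is hermsymmx.
Proof.
by apply/is_hermitianmxP; rewrite expr0 scale1r trmxC_mul trmxCK.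
Qed.

End ConjTranspose.

(** * Real diagonal matrices and determinant bounds for Gram matrices *)

Section RealDiag.
Variable R : realType.
Local Notation C := R[i].

Lemma realmx_row n (v : 'I_n -> R) : (\row_m (v m)%:C : 'rV[C]_n) \is a realmx.
Proof. by apply/mxOverP=> i j; rewrite mxE; apply/complex_realP; eexists. Qed.

Lemma real_diag_mxC n (v : 'I_n -> R) : (real_diag_mx v) ^t* = real_diag_mx v.
Proof. exact/trmxC_diag/realmx_row. Qed.

Lemma mul_real_diag n (v w : 'I_n -> R) :
  real_diag_mx v *m real_diag_mx w = real_diag_mx (fun m => v m * w m).
Proof.
rewrite /real_diag_mx mulmx_diag; congr diag_mx; apply/rowP=> i.
by rewrite !mxE rmorphM.
Qed.

Lemma real_diag1 n : real_diag_mx (fun=> 1) = 1%:M :> 'M[C]_n.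
Proof.
rewrite -diag_const_mx; congr diag_mx; apply/rowP=> i; by rewrite !mxE.
Qed.

Lemma add_real_diag n (v w : 'I_n -> R) :
  real_diag_mx v + real_diag_mx w = real_diag_mx (fun m => v m + w m).
Proof.
rewrite /real_diag_mx -raddfD; congr diag_mx; apply/rowP=> i.
by rewrite !mxE rmorphD.
Qed.

Lemma scale_real_diag n (c : R) (v : 'I_n -> R) :
  c%:C *: real_diag_mx v = real_diag_mx (fun m => c * v m).
Proof.
rewrite /real_diag_mx -linearZ; congr diag_mx; apply/rowP=> i.
by rewrite !mxE rmorphM.
Qed.

Lemma det_real_diag n (v : 'I_n -> R) :
  \det (real_diag_mx v) = (\prod_m v m)%:C.
Proof. by rewrite det_diag rmorph_prod; apply: eq_bigr => i _; rewrite mxE. Qed.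

Lemma trace_real_diag n (v : 'I_n -> R) :
  \tr (real_diag_mx v) = (\sum_m v m)%:C.
Proof.
by rewrite mxtrace_diag rmorph_sum; apply: eq_bigr => i _; rewrite mxE.
Qed.

Lemma real_diag_mulE n m (v : 'I_n -> R) (A : 'M[C]_(n, m)) i j :
  (real_diag_mx v *m A) i j = (v i)%:C * A i j.
Proof. by rewrite mul_diag_mx !mxE. Qed.

Lemma mul_real_diagE n m (v : 'I_n -> R) (A : 'M[C]_(m, n)) i j :
  (A *m real_diag_mx v) i j = A i j * (v j)%:C.
Proof. by rewrite mul_mx_diag !mxE. Qed.

(** Diagonalize and multiply [mu <= e^(mu - 1)] over the eigenvalues; multiplying the inequalities
    requires every eigenvalue to be nonnegative. *)
Lemma det_gram_le n p (F : 'M[C]_(n, p)) :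
  \det (F *m F ^t*) <= (expR (complex.Re (\tr (F *m F ^t*)) - n%:R))%:C.
Proof.
set A := F *m F ^t*.
have Ah : A \is hermsymmx by exact: gram_hermsymmx.
have /hermitian_normalmx/orthomx_spectralP := Ah.
set P := spectralmx A; set sp := spectral_diag A.
have Pu : P \is unitarymx by exact: spectral_unitarymx.
have PP : P *m P ^t* = 1%:M by exact/unitarymxP.
rewrite invmx_unitary // => AE.
(* In the eigenbasis the spectrum is itself the diagonal of a Gram matrix, hence nonnegative. *)
have spE : diag_mx sp = (P *m F) *m (P *m F) ^t*.
  rewrite trmxC_mul mulmxA -(mulmxA P) -/A AE.
  by rewrite !mulmxA PP mul1mx -mulmxA PP mulmx1.
have sp0 i : 0 <= sp 0 i.
  have := congr1 (fun X : 'M[C]_n => X i i) spE.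
  rewrite [X in X = _ -> _]mxE eqxx mulr1n => ->.
  exact: mulmxC_diag_ge0.
pose mu i := complex.Re (sp 0 i).
have muE i : sp 0 i = (mu i)%:C.
  by rewrite /mu RRe_real ?ger0_real.
have mu0 i : 0 <= mu i by have := sp0 i; rewrite muE lecR.
have spD : diag_mx sp = real_diag_mx mu.
  by rewrite /real_diag_mx; congr diag_mx; apply/rowP=> i; rewrite mxE muE.
have -> : \tr A = (\sum_i mu i)%:C.
  by rewrite AE -mulmxA mxtrace_mulC -mulmxA PP mulmx1 spD trace_real_diag.
have -> : \det A = (\prod_i mu i)%:C.
  rewrite AE -mulmxA det_mulmx mulrC -det_mulmx -mulmxA PP mulmx1 spD.
  exact: det_real_diag.
rewrite lecR /=.
have -> : n%:R = \sum_(i < n) (1 : R) by rewrite sumr_const card_ord.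
rewrite -sumrB expR_sum; apply: ler_prod => i _; rewrite mu0 /=.
by have := expR_ge1Dx (mu i - 1); rewrite addrC subrK.
Qed.

Lemma real_diag_gram n p (v : 'I_n -> R) (A : 'M[C]_(n, p)) :
  (real_diag_mx v *m A) *m (real_diag_mx v *m A) ^t* =
  real_diag_mx v *m (A *m A ^t*) *m real_diag_mx v.
Proof. by rewrite trmxC_mul real_diag_mxC !mulmxA. Qed.

(** A tangent bound: the exponent is the first-order term at [s] of the concave function
    [\sum_m ln (1 + c m * s m)]. The base point [s] is free here and becomes the water-filling
    powers later. *)
Lemma det_1D_diag_gram_le n p (c s : 'I_n -> R) (V : 'M[C]_(n, p)) :
  (forall m, 0 < c m) -> (forall m, 0 <= s m) ->
  \det (1%:M + real_diag_mx c *m (V *m V ^t*)) <=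
  ((\prod_m (1 + c m * s m)) *
   expR (\sum_m c m / (1 + c m * s m) *
      (complex.Re ((V *m V ^t*) m m) - s m)))%:C.
Proof.
move=> c0 s0.
pose D m := 1 + c m * s m.
have D0 m : 0 < D m by rewrite ltr_pwDl // mulr_ge0 // ltW.
pose r m := Num.sqrt (D m)^-1; pose w m := Num.sqrt (c m).
pose G := real_diag_mx r; pose W := real_diag_mx w *m V.
have rr m : r m * r m = (D m)^-1 by rewrite -expr2 sqr_sqrtr // invr_ge0 ltW.
have ww m : w m * w m = c m by rewrite -expr2 sqr_sqrtr // ltW.
pose F := row_mx G (G *m W).
have FF : F *m F ^t* = G *m (1%:M + W *m W ^t*) *m G.
  rewrite /F tr_row_mx map_col_mx mul_row_col -/(G ^t*) -/((G *m W) ^t*).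
  by rewrite real_diag_gram real_diag_mxC mulmxDr mulmxDl mulmx1.
have dF : \det (1%:M + real_diag_mx c *m (V *m V ^t*)) =
    (\prod_m D m)%:C * \det (F *m F ^t*).
  have -> : real_diag_mx c = real_diag_mx w *m real_diag_mx w :> 'M[C]_n.
    by rewrite mul_real_diag; congr real_diag_mx; apply/funext => m; rewrite ww.
  (* Sylvester's identity moves one square root of [c] to the right, which makes the product
     Hermitian. *)
  rewrite -mulmxA det_1D_mulmxC -real_diag_gram -/W FF !det_mulmx.
  rewrite mulrAC mulrA -[LHS]mul1r; congr (_ * _).
  rewrite -det_mulmx mul_real_diag det_real_diag -rmorphM -big_split /=.
  by rewrite big1 // => i _; rewrite rr divff // gt_eqF.
rewrite dF rmorphM /= ler_wpM2l //.
  by rewrite ler0c prodr_ge0 // => m _; exact: ltW.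
apply: le_trans (det_gram_le F) _.
rewrite lecR ler_expR.
have -> : n%:R = \sum_(i < n) (1 : R) by rewrite sumr_const card_ord.
rewrite /mxtrace raddf_sum -sumrB /= le_eqVlt; apply/orP; left; apply/eqP.
apply: eq_bigr => m _.
rewrite FF mul_real_diagE real_diag_mulE mxE mxE eqxx /W real_diag_gram.
rewrite mul_real_diagE real_diag_mulE.
set v := (V *m _) m m.
have -> : (r m)%:C * (1%:R + (w m)%:C * v * (w m)%:C) * (r m)%:C =
   ((r m * r m) %:C + (r m * r m)%:C * (w m * w m)%:C * v).
  by rewrite !rmorphM; ring.
rewrite rr ww -rmorphM.
have -> : complex.Re (((D m)^-1)%:C + ((D m)^-1 * c m)%:C * v) =
  (D m)^-1 + (D m)^-1 * c m * complex.Re v.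
  by case: v => a b /=; rewrite mul0r subr0.
rewrite -/(D m).
have := D0 m => /lt0r_neq0; rewrite /D => Dn.
by field.
Qed.

End RealDiag.

(** * Base-2 logarithms *)

Section Log2.
Variable R : realType.
Implicit Types x y : R.

Lemma ln2_gt0 : 0 < ln 2 :> R.
Proof. by rewrite ln_gt0 // ltr1n. Qed.

Lemma log2_prod n (f : 'I_n -> R) : (forall i, 0 < f i) ->
  log2 (\prod_i f i) = \sum_i log2 (f i).
Proof.
move=> f0; rewrite /log2 -mulr_suml; congr (_ / _).
rewrite -[RHS]expRK expR_sum; congr ln; apply: eq_bigr => i _.
by rewrite lnK // posrE.
Qed.

(* No positivity of x is needed because ln is 0 on nonpositive reals; this
   spares proving that the sensing determinant is positive. *)
Lemma ler_log2 x y : 1 <= y -> x <= y -> log2 x <= log2 y.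
Proof.
move=> y1 xy; rewrite /log2 ler_pM2r ?invr_gt0 ?ln2_gt0 //.
have [x0|x0] := ltP 0 x; first by rewrite ler_ln ?posrE // (lt_le_trans x0).
by rewrite (@le_trans _ _ 0) ?ln_ge0 // ln_le0 // (le_trans x0).
Qed.

Lemma log2M x y : 0 < x -> 0 < y -> log2 (x * y) = log2 x + log2 y.
Proof. by move=> x0 y0; rewrite /log2 lnM ?posrE // mulrDl. Qed.

End Log2.

(** * Water-filling powers: existence and uniqueness of the level *)

Section WaterFilling.
Variables (R : realType) (M : nat) (sigma2 : R) (lam : 'I_M -> R).
Hypotheses (sigma2_gt0 : 0 < sigma2) (lam_gt0 : forall m, 0 < lam m).

Implicit Types (ps nu : R).

Let a m := sigma2 / lam m.
Let a_gt0 m : 0 < a m. Proof. by rewrite divr_gt0. Qed.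

Lemma water_power_ge0 nu m : 0 <= water_power sigma2 lam nu m.
Proof. by rewrite /water_power le_max lexx. Qed.

(** Complementary slackness. The slope equals [(a m + s)^-1]: on an active channel this is exactly
    [nu]; on an inactive one [s = 0] and the slope is at most [nu], while [v - s = v] is
    nonnegative. *)
Lemma water_power_slope_le nu m (v : R) : 0 < nu -> 0 <= v ->
  sigma2^-1 * lam m / (1 + sigma2^-1 * lam m * water_power sigma2 lam nu m) *
    (v - water_power sigma2 lam nu m) <= nu * (v - water_power sigma2 lam nu m).
Proof.
move=> nu0 v0; set s := water_power sigma2 lam nu m.
have -> : sigma2^-1 * lam m / (1 + sigma2^-1 * lam m * s) = (a m + s)^-1.
  have h1 := lt0r_neq0 (lam_gt0 m); have h2 := lt0r_neq0 sigma2_gt0.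
  have h3 : sigma2 + s * lam m != 0.
    by rewrite gt_eqF // ltr_pwDl // mulr_ge0 ?water_power_ge0 // ltW.
  rewrite /a; field.
  by rewrite h1 h2 h3.
rewrite /s /water_power -/(a m); case: (leP (nu^-1 - a m) 0) => h.
  rewrite addr0 subr0 ler_wpM2r // -[leRHS]invrK lef_pV2 ?posrE ?invr_gt0 //.
  by rewrite -subr_le0.
by rewrite addrC subrK invrK.
Qed.

(** Powers decrease weakly in [nu], so equal sums force equal powers on every channel. At two
    distinct levels this is possible only if all powers vanish, contradicting [0 < ps]. *)
Lemma water_level_uniq ps nu nu' : 0 < ps ->
  water_level sigma2 lam ps nu -> water_level sigma2 lam ps nu' -> nu = nu'.
Proof.
move=> ps0; wlog le_nu : nu nu' / nu <= nu'.
  move=> H h h'; have [/H|/ltW/H] := leP nu nu'; first exact.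
  by move=> /(_ h' h).
move=> [nu0 E] [nu'0 E']; apply/eqP/negPn/negP => ne.
have {ne le_nu}lt_nu : nu'^-1 < nu^-1.
  by rewrite ltf_pV2 ?posrE // lt_neqAle ne.
have le_w m : 0 <= water_power sigma2 lam nu m - water_power sigma2 lam nu' m.
  rewrite /water_power /Num.max /Order.max -!/(a m).
  by do 2 case: ltP => ?; lra.
have /psumr_eq0P eq_w :
    \sum_m (water_power sigma2 lam nu m - water_power sigma2 lam nu' m) = 0.
  by rewrite sumrB E E' subrr.
move: ps0; rewrite -E big1 ?ltxx // => m _.
have := eq_w (fun m _ => le_w m) m isT.
by rewrite /water_power /Num.max /Order.max -!/(a m); do 2 case: ltP => ?; lra.
Qed.

(** Intermediate value theorem in the variable [t = nu^-1], in which the total power [g] is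
    continuous. *)
Lemma water_level_exists ps : (0 < M)%N -> 0 < ps ->
  exists nu, water_level sigma2 lam ps nu.
Proof.
move=> M0 ps0.
pose g t := \sum_(m < M) Num.max 0 (t - a m).
(* At this endpoint the first channel alone already receives at least [ps]. *)
pose b := ps + \sum_m a m.
have b0 : 0 <= b by rewrite addr_ge0 ?sumr_ge0 ?(ltW ps0) // => m _; exact: ltW.
have g0 : g 0 = 0.
  by rewrite /g big1 // => m _; apply/max_idPl; rewrite sub0r oppr_le0 ltW.
have gb : ps <= g b.
  rewrite /g (bigD1 (Ordinal M0)) //= ler_wpDr ?sumr_ge0 //.
    by move=> m _; rewrite le_max lexx.
  rewrite le_max; apply/orP; right.
  rewrite /b (bigD1 (Ordinal M0)) //= addrCA addrC addrK lerDl.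
  by rewrite sumr_ge0 // => m _; exact: ltW.
have cg : {within `[0, b], continuous g}.
  apply: continuous_subspaceT => t.
  apply: (continuous_big (op := +%R)) => [|m _ {}t].
    exact: add_continuous.
  apply: (@continuous_max _ _ (cst 0) (fun t => t - a m)); first exact: cvg_cst.
  by apply: cvgB; [exact: cvg_id|exact: cvg_cst].
have [|t tb gt] := @IVT _ g 0 b ps b0 cg.
  by rewrite g0 min_l ?max_r ?(ltW ps0) ?(le_trans (ltW ps0)).
have t0 : 0 < t.
  rewrite lt_neqAle; move: tb; rewrite in_itv /= => /andP[-> _]; rewrite andbT.
  apply/negP => /eqP t0; move: gt; rewrite -t0 g0 => e.
  by rewrite -e ltxx in ps0.
exists t^-1; split; first by rewrite invr_gt0.
by rewrite -[RHS]gt /water_power invrK.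
Qed.

End WaterFilling.

(** * Upper bound on the sensing information and its attainment *)

Section Optimum.
Variables (R : realType) (M N L : nat) (sigma2 : R) (lam : 'I_M -> R).
Variable UT : 'M[R[i]]_M.
Hypotheses (sigma2_gt0 : 0 < sigma2) (lam_gt0 : forall m, 0 < lam m).
Hypothesis UT_unitary : UT \is unitarymx.
Let RT := UT ^t* *m real_diag_mx lam *m UT.
Let c m := sigma2^-1 * lam m.
Let c_gt0 m : 0 < c m. Proof. by rewrite mulr_gt0 // invr_gt0. Qed.

(** Sylvester's identity turns the determinant of size [L] into one of size [M], written in the
    eigenbasis of [RT]. *)
Lemma sensing_detE (S : 'M[R[i]]_(M, L)) :
  \det (1%:M + (sigma2^-1)%:C *: (S ^t* *m RT *m S)) =
  \det (1%:M + real_diag_mx c *m ((UT *m S) *m (UT *m S) ^t*)).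
Proof.
have -> : (sigma2^-1)%:C *: (S ^t* *m RT *m S) =
    (UT *m S) ^t* *m (real_diag_mx c *m (UT *m S)).
  by rewrite -scale_real_diag -scalemxAl -scalemxAr trmxC_mul !mulmxA.
by rewrite det_1D_mulmxC -(mulmxA (real_diag_mx c)).
Qed.

Lemma sensing_mi_le ps nu (S : 'M[R[i]]_(M, L)) :
  water_level sigma2 lam ps nu -> \tr (S *m S ^t*) <= ps%:C ->
  sensing_mi N sigma2 RT S <=
  N%:R * \sum_(m < M)
    log2 (1 + sigma2^-1 * lam m * water_power sigma2 lam nu m).
Proof.
move=> [nu0 nuE] trS; rewrite ler_wpM2l ?ler0n //.
have D1 m : 1 <= 1 + c m * water_power sigma2 lam nu m.
  by rewrite lerDl mulr_ge0 ?water_power_ge0 // ltW.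
rewrite -log2_prod; last by move=> m; rewrite (lt_le_trans ltr01) ?D1.
set V := UT *m S.
have /= := det_1D_diag_gram_le V c_gt0 (water_power_ge0 sigma2 lam nu).
rewrite -sensing_detE lecE => /andP[_ /= dle].
apply: ler_log2.
  apply: (big_ind (fun x => 1 <= x)) => // [x y|m _].
    exact: mulr_ege1.
  exact: D1.
apply: le_trans dle _.
rewrite ger_pMr; last first.
  by apply: prodr_gt0 => m _; rewrite (lt_le_trans ltr01) ?D1.
rewrite -[leRHS]expR0 ler_expR.
(* Replacing all slopes by the common multiplier [nu] collapses the exponent to [nu] times the
   excess of the trace over [ps]. *)
apply: (@le_trans _ _ (\sum_m nu *
    (complex.Re ((V *m V ^t*) m m) - water_power sigma2 lam nu m))).
  apply: ler_sum => m _; apply: (water_power_slope_le sigma2_gt0 lam_gt0 m nu0).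
  by have := mulmxC_diag_ge0 V m; rewrite lecE => /andP[].
rewrite -mulr_sumr sumrB nuE pmulr_rle0 // subr_le0 -raddf_sum -/(mxtrace _).
(* The unitary [UT] leaves the trace unchanged, so the power constraint on [S] applies to [V]. *)
rewrite /V trmxC_mul -mulmxA mxtrace_mulC !mulmxA mulmxKtV //.
by move: trS; rewrite lecE => /andP[].
Qed.

Lemma sensing_mi_water nu (S : 'M[R[i]]_(M, L)) :
  S *m S ^t* = UT ^t* *m real_diag_mx (water_power sigma2 lam nu) *m UT ->
  sensing_mi N sigma2 RT S =
  N%:R * \sum_(m < M)
    log2 (1 + sigma2^-1 * lam m * water_power sigma2 lam nu m).
Proof.
move=> SE; rewrite /sensing_mi sensing_detE -log2_prod; last first.
  by move=> m; rewrite ltr_pwDl // mulr_ge0 ?water_power_ge0 // ltW // c_gt0.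
have UU : UT *m UT ^t* = 1%:M by exact/unitarymxP.
rewrite trmxC_mul -!mulmxA (mulmxA S) SE.
rewrite !mulmxA; rewrite -(mulmxA (real_diag_mx c) UT) UU mulmx1.
rewrite -!(mulmxA _ UT) UU mulmx1 mul_real_diag -real_diag1 add_real_diag.
by rewrite det_real_diag.
Qed.

Lemma trace_water ps nu (S : 'M[R[i]]_(M, L)) :
  water_level sigma2 lam ps nu ->
  S *m S ^t* = UT ^t* *m real_diag_mx (water_power sigma2 lam nu) *m UT ->
  \tr (S *m S ^t*) = ps%:C.
Proof.
move=> [_ <-] ->; have UU : UT *m UT ^t* = 1%:M by exact/unitarymxP.
by rewrite -mulmxA mxtrace_mulC -mulmxA UU mulmx1 trace_real_diag.
Qed.

Lemma gram_surj (s : 'I_M -> R) : (M <= L)%N -> (forall m, 0 <= s m) ->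
  exists S : 'M[R[i]]_(M, L), S *m S ^t* = UT ^t* *m real_diag_mx s *m UT.
Proof.
move=> ML s0; pose r m := Num.sqrt (s m).
(* Since [M <= L], the rectangular identity [pid_mx M] has orthonormal rows and disappears from the
   Gram matrix. *)
exists (UT ^t* *m (real_diag_mx r *m pid_mx M)).
rewrite trmxC_mul trmxCK mulmxA; congr (_ *m _).
rewrite -mulmxA real_diag_gram tr_pid_mx map_pid_mx pid_mx_id // pid_mx_1 mulmx1.
rewrite mul_real_diag; congr (_ *m real_diag_mx _); apply/funext => m.
by rewrite -expr2 sqr_sqrtr.
Qed.

End Optimum.

(** * Entries of positive semidefinite matrices *)

Section Psd.
Variables (R : realType) (n : nat) (A : 'M[R[i]]_n).
Hypothesis A_psd : psdmx A.

Lemma psdmx_conj i j : A j i = (A i j)^*.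
Proof.
have [/is_hermitianmxP + _] := A_psd.
by rewrite expr0 scale1r => AE; rewrite {1}AE !mxE.
Qed.

Lemma psdmx_conjugation_diag_ge0 p (U : 'M[R[i]]_(p, n)) i :
  0 <= (U *m A *m U ^t*) i i.
Proof.
have [_ /(_ ((row i U) ^t*))] := A_psd.
rewrite trmxCK -row_mul; congr (0 <= _).
by rewrite mxE [RHS]mxE; apply: eq_bigr => j _; rewrite [row _ _ _ _]mxE !mxE.
Qed.

Lemma psdmx_diag_ge0 i : 0 <= A i i.
Proof.
have := psdmx_conjugation_diag_ge0 1%:M i.
by rewrite trmx1 map_mx1 mul1mx mulmx1.
Qed.

Lemma psdmx_pair_ge0 i j (z : R[i]) :
  0 <= A i i + z * A i j + z^* * A j i + z * z^* * A j j.
Proof.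
have [_ /(_ (delta_mx i 0 + z *: delta_mx j 0))] := A_psd.
rewrite [(_ + _)^T]linearD /= [(_ *: _)^T]linearZ /= map_mxD map_mxZ.
rewrite !trmx_delta !map_delta_mx !mulmxDl !mulmxDr -!scalemxAl -!scalemxAr.
rewrite -!rowE -!colE !mxE => H.
by rewrite (le_trans H) // le_eqVlt; apply/orP; left; apply/eqP; ring.
Qed.

(** The quadratic form at [e_i + z e_j] with [z = 1, -1] bounds the real part by the mean of two
    diagonal entries, and with [z = i, -i] the imaginary part. Each diagonal entry is at most the
    trace. *)
Lemma psdmx_entry_le i j :
  `|complex.Re (A i j)| <= complex.Re (\tr A) /\
  `|complex.Im (A i j)| <= complex.Re (\tr A).
Proof.
have conjCE (z : R[i]) : Num.conj z = conjc z by [].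
have dg k : 0 <= complex.Re (A k k).
  by have := psdmx_diag_ge0 k; rewrite lecE => /andP[].
have le_tr k : complex.Re (A k k) <= complex.Re (\tr A).
  rewrite /mxtrace raddf_sum /= (bigD1 k) //= lerDl sumr_ge0 //.
have hi := le_tr i; have hj := le_tr j.
have rel (z : R[i]) :
    0 <= complex.Re (A i i + z * A i j + z^* * A j i + z * z^* * A j j).
  by have := psdmx_pair_ge0 i j z; rewrite lecE => /andP[].
have h1 := rel 1; have h2 := rel (-1).
have h3 := rel 'i%C; have h4 := rel (- 'i%C).
move: h1 h2 h3 h4; rewrite (psdmx_conj i j) !conjCE; move: hi hj.
move: (A i i) (A j j) (A i j) => [a a'] [b b'] [x y] /=.
move: (complex.Re (\tr A)) => t hi hj h1 h2 h3 h4.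
by rewrite !ler_norml; split; apply/andP; split; lra.
Qed.

End Psd.

(** * Averages of bounded random matrices *)

Section Integral.
Context {R : realType} {d : measure_display} {T : measurableType d}.
Variable P : probability T R.
Implicit Types (f g : T -> R) (b u v : R).

(** Integrability travels with the value, so linearity applies through nested sums without separate
    side goals. *)
Definition has_mean (f : T -> R) (v : R) :=
  P.-integrable setT (EFin \o f) /\ \int[P]_x f x = v.

Lemma has_meanD f g u v : has_mean f u -> has_mean g v ->
  has_mean (fun w => f w + g w) (u + v).
Proof.
move=> [fi <-] [gi <-]; split; last by rewrite RintegralD.
exact: integrableD fi gi.
Qed.

Lemma has_meanZ k f u : has_mean f u -> has_mean (fun w => k * f w) (k * u).
Proof.
move=> [fi <-]; split; last by rewrite RintegralZl.
exact: (integrableZl measurableT k fi).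
Qed.

Lemma has_mean0 : has_mean (fun=> 0) 0.
Proof.
split; first exact: integrable0.
by rewrite /Rintegral integral0.
Qed.

Lemma has_mean_sum (I : Type) (r : seq I) (f : I -> T -> R) (u : I -> R) :
  (forall i, has_mean (f i) (u i)) ->
  has_mean (fun w => \sum_(i <- r) f i w) (\sum_(i <- r) u i).
Proof.
move=> fu; elim: r => [|i r IH].
  rewrite big_nil; under eq_fun do rewrite big_nil; exact: has_mean0.
rewrite big_cons; under eq_fun do rewrite big_cons; exact: has_meanD.
Qed.

Lemma has_mean_ge0 f v : (forall w, 0 <= f w) -> has_mean f v -> 0 <= v.
Proof. by move=> f0 [_ <-]; apply: Rintegral_ge0. Qed.

Lemma bounded_has_mean f b : measurable_fun setT f -> (forall w, `|f w| <= b) ->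
  has_mean f (fine 'E_P[f]).
Proof.
move=> mf fb; split; last by rewrite unlock.
apply: measurable_bounded_integrable => //.
  by rewrite [X in (X < _)%E](probability_setT P) ltry.
exists b; split; first exact: num_real.
by move=> x bx w _ /=; apply: le_trans (fb w) _; exact: ltW.
Qed.

(** The real part of the trace is real-linear in the entries, so it commutes with the expectation.
    Semidefiniteness and the trace bound [b] make every entry bounded, hence integrable. *)
Lemma trace_expectation_cmx_ge0 n (A : 'M[R[i]]_n) (X : T -> 'M[R[i]]_n) b :
  measurable_cmx X -> (forall w, psdmx (X w)) ->
  (forall w, complex.Re (\tr (X w)) <= b) ->
  (forall w, 0 <= complex.Re (\tr (A *m X w))) ->
  0 <= complex.Re (\tr (A *m expectation_cmx P X)).
Proof.
move=> mX psdX trX AX.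
have trE (B : 'M[R[i]]_n) : complex.Re (\tr (A *m B)) =
   \sum_i \sum_j (complex.Re (A i j) * complex.Re (B j i) +
                  - complex.Im (A i j) * complex.Im (B j i)).
  rewrite /mxtrace raddf_sum; apply: eq_bigr => i _.
  rewrite mxE raddf_sum; apply: eq_bigr => j _ /=.
  by case: (A i j) => a a'; case: (B j i) => c c' /=; rewrite mulNr.
apply: (has_mean_ge0 AX).
under eq_fun do rewrite trE.
rewrite trE; apply: has_mean_sum => i; apply: has_mean_sum => j.
rewrite mxE /=.
have bnd w := psdmx_entry_le (psdX w) j i.
have [mRe mIm] := mX j i.
apply: has_meanD; apply: has_meanZ; apply: (@bounded_has_mean _ b) => // w;
  by rewrite (le_trans _ (trX w)) //; case: (bnd w).
Qed.

End Integral.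

(** * Nonnegativity of the communication interference *)

Section Noise.
Variables (R : realType) (n : nat).

(** By cyclicity the trace is the sum of the diagonal entries of [U *m A *m U ^t*], all nonnegative,
    with weights [lam m]. *)
Lemma trace_mul_psdmx_ge0 (U A : 'M[R[i]]_n) (lam : 'I_n -> R) :
  (forall m, 0 < lam m) -> psdmx A ->
  0 <= complex.Re (\tr (U ^t* *m real_diag_mx lam *m U *m A)).
Proof.
move=> lam0 Apsd.
have -> : \tr (U ^t* *m real_diag_mx lam *m U *m A) =
    \tr (real_diag_mx lam *m (U *m A *m U ^t*)).
  by rewrite -!mulmxA mxtrace_mulC -!mulmxA.
rewrite /mxtrace raddf_sum sumr_ge0 //= => m _; rewrite real_diag_mulE.
have := psdmx_conjugation_diag_ge0 Apsd U m.
move: (_ m m) => [a a'] /=; rewrite lecE /= => /andP[_ a0].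
by rewrite mul0r subr0 mulr_ge0 // ltW.
Qed.

Lemma psdmx_sum (I : finType) (F : I -> 'M[R[i]]_n) :
  (forall i, psdmx (F i)) -> psdmx (\sum_i F i).
Proof.
move=> Fp; split.
  apply/is_hermitianmxP; rewrite expr0 scale1r raddf_sum /= map_mx_sum.
  apply: eq_bigr => i _; have [/is_hermitianmxP] := Fp i.
  by rewrite expr0 scale1r.
move=> x; rewrite mulmx_sumr mulmx_suml summxE sumr_ge0 // => i _.
by have [_] := Fp i.
Qed.

End Noise.

(** * The maximal rate and its high-SNR behaviour *)

Section MaxRate.
Variables (R : realType) (M N L : nat) (sigma2 : R) (lam : 'I_M -> R).
Variable UT : 'M[R[i]]_M.
Hypotheses (sigma2_gt0 : 0 < sigma2) (lam_gt0 : forall m, 0 < lam m).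
Hypotheses (UT_unitary : UT \is unitarymx) (ML : (M <= L)%N).
Let RT := UT ^t* *m real_diag_mx lam *m UT.

Lemma is_max_water ps nu : water_level sigma2 lam ps nu ->
  is_max (sensing_mi_values N L sigma2 RT ps)
    (N%:R * \sum_(m < M)
      log2 (1 + sigma2^-1 * lam m * water_power sigma2 lam nu m)).
Proof.
move=> hnu; split; last first.
  move=> _ [S trS <-].
  exact: (sensing_mi_le N sigma2_gt0 lam_gt0 UT_unitary hnu trS).
have [S SE] := gram_surj UT ML (water_power_ge0 sigma2 lam nu).
exists S; last exact: sensing_mi_water.
by rewrite /= (trace_water UT_unitary hnu SE).
Qed.

Lemma is_max_sup (E : set R) x : is_max E x -> sup E = x.
Proof.
move=> [Ex ubx]; apply/eqP; rewrite eq_le; apply/andP; split.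
  by apply: ge_sup => //; exists x.
by apply: ub_le_sup => //; exists x.
Qed.

Lemma max_sensing_rate_water ps nu : water_level sigma2 lam ps nu ->
  max_sensing_rate N L sigma2 RT ps = N%:R / L%:R *
   (\sum_(m < M) log2 (1 + sigma2^-1 * lam m * water_power sigma2 lam nu m)).
Proof.
move=> /is_max_water/is_max_sup; rewrite /max_sensing_rate => ->.
by rewrite mulrCA mulrA.
Qed.

Let a m := sigma2 / lam m.
Let a_gt0 m : 0 < a m. Proof. by rewrite divr_gt0. Qed.

(** The value of [t] comes from solving [\sum_m (t - a m) = ps] with all channels active. *)
Lemma water_level_high ps : (0 < M)%N -> 0 < ps -> M%:R * \sum_m a m <= ps ->
  let t := (ps + \sum_m a m) / M%:R in
  [/\ 0 < t, water_level sigma2 lam ps t^-1 &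
      forall m, water_power sigma2 lam t^-1 m = t - a m].
Proof.
move=> M0 ps0 ps_ge t.
have Mr : 0 < M%:R :> R by rewrite ltr0n.
have s0 : 0 <= \sum_m a m by rewrite sumr_ge0 // => m _; exact: ltW.
have t0 : 0 < t by rewrite divr_gt0 // ltr_pwDl.
(* The threshold gives [a m <= \sum_m a m <= ps / M <= t]. *)
have at_ m : a m <= t.
  rewrite ler_pdivlMr // (@le_trans _ _ ps) ?lerDl //.
  apply: le_trans ps_ge; rewrite mulrC ler_wpM2l ?(ltW Mr) //.
  by rewrite (bigD1 m) //= lerDl sumr_ge0 // => k _; exact: ltW.
have wE m : water_power sigma2 lam t^-1 m = t - a m.
  by rewrite /water_power invrK max_r // subr_ge0; exact: at_.
split => //; split; first by rewrite invr_gt0.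
rewrite (eq_bigr (fun m => t - a m)) => [|m _]; last exact: wE.
rewrite sumrB sumr_const card_ord -mulr_natr divfK ?gt_eqF //.
by rewrite addrK.
Qed.

Lemma max_sensing_rate_high_snr ps : (0 < M)%N -> 0 < ps ->
  M%:R * \sum_m a m <= ps ->
  max_sensing_rate N L sigma2 RT ps -
     N%:R * M%:R / L%:R *
       (log2 ps + M%:R^-1 * \sum_(m < M) log2 (lam m / (M%:R * sigma2))) =
  N%:R * M%:R / L%:R * log2 (1 + (\sum_m a m) / ps).
Proof.
move=> M0 ps0 /(water_level_high M0 ps0).
set t := _ / M%:R => -[t0 hnu wE].
have Mr : 0 < M%:R :> R by rewrite ltr0n.
have s0 : 0 <= \sum_m a m by rewrite sumr_ge0 // => m _; exact: ltW.
(* With every channel active the factor is [t / a m]; extracting [ps] from [t] leaves a correction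
   common to all channels. *)
have fac m : 1 + sigma2^-1 * lam m * water_power sigma2 lam t^-1 m =
    ps * (lam m / (M%:R * sigma2)) * (1 + (\sum_m a m) / ps).
  have h1 := lt0r_neq0 (lam_gt0 m); have h2 := lt0r_neq0 sigma2_gt0.
  have h3 := lt0r_neq0 ps0; have h4 := lt0r_neq0 Mr.
  rewrite wE /t; move: (\sum_m a m) => s; rewrite /a; field.
  by rewrite h1 h2 h3 h4.
rewrite (max_sensing_rate_water hnu).
have c0 : 0 < 1 + (\sum_m a m) / ps by rewrite ltr_pwDl // divr_ge0 // ltW.
have d0 m : 0 < lam m / (M%:R * sigma2) by rewrite divr_gt0 // mulr_gt0.
pose ell m := log2 ps + log2 (lam m / (M%:R * sigma2)) +
  log2 (1 + (\sum_m a m) / ps).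
rewrite (eq_bigr ell) => [|m _]; last first.
  by rewrite fac (log2M (mulr_gt0 ps0 (d0 m)) c0) (log2M ps0 (d0 m)).
rewrite /ell !big_split /= !sumr_const card_ord.
have M_neq0 := lt0r_neq0 Mr.
rewrite -(mulr_natr (log2 ps)) -(mulr_natr (log2 (1 + _))).
rewrite !mulrDr.
have -> : N%:R * M%:R / L%:R *
      (M%:R^-1 * \sum_m log2 (lam m / (M%:R * sigma2))) =
    N%:R / L%:R * \sum_m log2 (lam m / (M%:R * sigma2)) :> R.
  by rewrite mulrA; congr (_ * _); rewrite mulrAC mulfK.
ring.
Qed.

(** For all large [ps] the error equals the common logarithmic correction, whose argument tends to
    1. *)
Lemma max_sensing_rate_asymptotics : (0 < M)%N ->
  (fun ps : R =>
     max_sensing_rate N L sigma2 RT ps -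
     N%:R * M%:R / L%:R *
       (log2 ps + M%:R^-1 * \sum_(m < M) log2 (lam m / (M%:R * sigma2))))
    @ +oo --> (0 : R).
Proof.
move=> M0.
have lim : N%:R * M%:R / L%:R * log2 (1 + (\sum_m a m) / ps)
    @[ps --> +oo] --> (0 : R).
  rewrite -[X in _ --> X](mulr0 (N%:R * M%:R / L%:R)).
  apply: cvgM; first exact: cvg_cst.
  rewrite [X in _ --> X](_ : 0 = ln (1 + (\sum_m a m) * 0) / ln 2); last first.
    by rewrite mulr0 addr0 ln1 mul0r.
  apply: cvgM; last exact: cvg_cst.
  apply: continuous_cvg; first by apply: continuous_ln; rewrite mulr0 addr0.
  apply: cvgD; first exact: cvg_cst.
  apply: cvgM; first exact: cvg_cst.
  by apply/(gtr0_cvgV0 (f := id)); [exact: nbhs_pinfty_gt|exact: cvg_id].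
apply: cvg_trans lim; apply: near_eq_cvg.
near=> ps.
by rewrite max_sensing_rate_high_snr.
Unshelve. all: by end_near.
Qed.

End MaxRate.

Unset Implicit Arguments.

Theorem theorem3 (R : realType)
    (M N L K : nat) (hM : (0 < M)%N) (hN : (0 < N)%N) (hL : (0 < L)%N)
    (hLM : (M <= L)%N) (hLN : (N <= L)%N)
    (hK : (0 < K)%N) (hKM : (K <= M)%N) (hKN : (K <= N)%N)
    (RT : 'M[R[i]]_M) (hRT : pdmx RT)
    (UT : 'M[R[i]]_M) (hUT : UT \is unitarymx)
    (lam : 'I_M -> R) (hlam : forall m, 0 < lam m)
    (hdec : RT = UT ^t* *m real_diag_mx lam *m UT)
    (d : measure_display) (T : measurableType d) (P : probability T R)
    (Rk : 'I_K -> 'M[R[i]]_M) (hRk : forall k, psdmx (Rk k))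
    (Hd : T -> 'M[R[i]]_(M, K))
    (hgauss : forall k, complex_normal P (Rk k) (fun w => col k (Hd w)))
    (hindep : independent_columns P Hd)
    (pc : R) (hpc : 0 < pc)
    (Q : 'M[R[i]]_(M, K) -> 'I_K -> 'M[R[i]]_M)
    (hQ : forall H, dpc_optimal pc H (Q H))
    (hQmeas : measurable_cmx (fun w => \sum_(k < K) Q (Hd w) k))
    (Sigma : 'M[R[i]]_M)
    (hSigma : Sigma = expectation_cmx P (fun w => \sum_(k < K) Q (Hd w) k))
    (sigma2 : R) (hsigma2 : sigma2 = noise_power RT Sigma) :
  (forall ps : R, 0 < ps ->
     is_max (sensing_mi_values N L sigma2 RT ps)
       (sup (sensing_mi_values N L sigma2 RT ps)) /\
     (exists! nu : R, water_level sigma2 lam ps nu) /\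
     (forall nu : R, water_level sigma2 lam ps nu ->
        max_sensing_rate N L sigma2 RT ps =
          N%:R / L%:R * (\sum_(m < M)
             log2 (1 + sigma2^-1 * lam m * water_power sigma2 lam nu m)) /\
        (exists S : 'M[R[i]]_(M, L),
           S *m S ^t* =
           UT ^t* *m real_diag_mx (water_power sigma2 lam nu) *m UT) /\
        (forall S : 'M[R[i]]_(M, L),
           S *m S ^t* =
             UT ^t* *m real_diag_mx (water_power sigma2 lam nu) *m UT ->
           \tr (S *m S ^t*) <= ps%:C /\
           L%:R^-1 * sensing_mi N sigma2 RT S =
             max_sensing_rate N L sigma2 RT ps))) /\
  (fun ps : R =>
     max_sensing_rate N L sigma2 RT ps -
     N%:R * M%:R / L%:R *
       (log2 ps + M%:R^-1 * \sum_(m < M) log2 (lam m / (M%:R * sigma2))))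
    @ +oo --> (0 : R).
Proof.
(* The power budget bounds the trace uniformly over all channels, which supplies the integrability
   behind [0 < sigma2]. *)
have tr_le H : complex.Re (\tr (\sum_(k < K) Q H k)) <= pc.
  by have [[_ +] _] := hQ H; rewrite lecE => /andP[].
have sigma2_gt0 : 0 < sigma2.
  rewrite hsigma2 /noise_power ltr_pwDl // hSigma.
  have psd w : psdmx (\sum_(k < K) Q (Hd w) k).
    by apply: psdmx_sum => k; have [[]] := hQ (Hd w).
  apply: (@trace_expectation_cmx_ge0 _ _ _ P _ _ _ pc) => // w.
  by rewrite hdec; apply: trace_mul_psdmx_ge0.
split=> [ps ps_gt0|]; last by rewrite hdec; apply: max_sensing_rate_asymptotics.
have [nu0 hnu0] := water_level_exists sigma2_gt0 hlam hM ps_gt0.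
split; [|split].
- have := is_max_water N sigma2_gt0 hlam hUT hLM hnu0.
  by rewrite hdec => mx; rewrite (is_max_sup mx).
- by exists nu0; split=> // nu; apply: (water_level_uniq ps_gt0 hnu0).
- move=> nu hnu.
  have rateE := max_sensing_rate_water N sigma2_gt0 hlam hUT hLM hnu.
  rewrite hdec; split; [exact: rateE|split].
    exact: (gram_surj UT hLM (water_power_ge0 sigma2 lam nu)).
  move=> S SE; split; first by rewrite (trace_water hUT hnu SE).
  by rewrite rateE (sensing_mi_water N sigma2_gt0 hlam hUT SE) mulrCA mulrA.
Qed.
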